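(* Let $G\in\mathbb{R}^{m\times n}$. Then the following expressions are equivalent: (i) $\operatorname{rank}(G)\leq r$; (ii) there exists $W_R\in\Phi_{n,r}$ such that $GW_R=0_{m\times n}$; (iii) there exists $W_L\in\Phi_{m,r}$ such that $W_LG=0_{m\times n}$.
   Context: $r$ is a given number, on which no further condition is stated. $\mathbb{S}^n$ denotes the set of real symmetric $n\times n$ matrices. For symmetric matrices $A,B$ of the same size, $A\succeq 0$ means that $A$ is positive semidefinite, and $A\succeq B$ (equivalently $B\preceq A$) means $A-B\succeq 0$. $I$ is the identity matrix of the appropriate size, and $0_{m\times n}$ is the $m\times n$ zero matrix. The set $\Phi_{n,r}$ is defined by $$\Phi_{n,r}=\{W\in\mathbb{S}^n : 0\preceq W\preceq I,\ \operatorname{trace}(W)=n-r\},$$ and $\Phi_{m,r}$ is defined in the same way with $m$ in place of $n$.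
   Formalization: The conditions r ≤ m and r ≤ n are added; without them the equivalence fails, since for r > n (or r > m) the rank bound (i) always holds while Φ_{n,r} (or Φ_{m,r}) is empty, e.g. m = n = 1, G = 0, r = 2. *)

(* Defs.v *)
From mathcomp Require Export all_boot all_order all_algebra sesquilinear.
From mathcomp Require Export classical_sets reals.
Export Order.TTheory GRing.Theory Num.Theory.

Set Implicit Arguments.
Unset Strict Implicit.
Unset Printing Implicit Defensive.

Local Open Scope classical_set_scope.
Local Open Scope ring_scope.

Definition psdmx (R : realType) (n : nat) (A : 'M[R]_n) : Prop :=
  A \is symmetricmx /\ forall x : 'cV[R]_n, 0 <= (x^T *m A *m x) 0 0.

Definition loewner_le (R : realType) (n : nat) (A B : 'M[R]_n) : Prop :=
  psdmx (B - A).

(* r is a real number: it need be neither an integer nor nonnegative. *)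
Definition Phi (R : realType) (n : nat) (r : R) : set 'M[R]_n :=
  [set W | [/\ W \is symmetricmx, loewner_le 0 W, loewner_le W 1%:M
             & \tr W = n%:R - r]].
Arguments Phi {R} n r.

(* Main.v *)
Require Import Defs.

Local Open Scope ring_scope.

(**
Let [P] be the orthogonal projector onto the kernel of [G]; its trace is
[n - \rank G]. If [\rank G <= r], then the multiple of [P] with trace [n - r]
lies in [Phi n r] and is annihilated by [G]. Conversely, if [G *m W = 0] then
[W = P *m W *m P], so [W <= 1] gives [\tr W <= \tr P], which avoids any
spectral decomposition of [W]. The left version follows by transposition.
*)

Lemma symmetricmxP (R : fieldType) (n : nat) (A : 'M[R]_n) :
  reflect (A^T = A) (A \is symmetricmx).
Proof.
rewrite is_hermitianmxE expr0 scale1r map_mx_id // eq_sym.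
exact: eqP.
Qed.

Lemma gram_diagE (R : nzRingType) (m n : nat) (A : 'M[R]_(m, n)) (i : 'I_m) :
  (A *m A^T) i i = \sum_j A i j * A i j.
Proof. by rewrite mxE; apply: eq_bigr => j _; rewrite mxE. Qed.

Lemma gram_diag_ge0 (R : realDomainType) (m n : nat) (A : 'M[R]_(m, n))
  (i : 'I_m) : 0 <= (A *m A^T) i i.
Proof. by rewrite gram_diagE sumr_ge0 // => j _; rewrite -expr2 sqr_ge0. Qed.

(** Each diagonal entry of [A *m A^T] is the sum of squares of a row of [A], so it vanishes only
    with the whole row. *)
Lemma gram_eq0 (R : realDomainType) (m n : nat) (A : 'M[R]_(m, n)) :
  A *m A^T = 0 -> A = 0.
Proof.
move=> AA0; apply/matrixP => i j; rewrite mxE.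
have /eqP := congr1 (fun M : 'M_m => M i i) AA0.
rewrite gram_diagE mxE psumr_eq0 => [|k _]; last by rewrite -expr2 sqr_ge0.
by move=> /allP/(_ j (mem_index_enum j)); rewrite mulf_eq0 orbb => /eqP.
Qed.

(** If [v] kills [A *m A^T], then [v *m A] has zero Gram matrix, hence is zero, and row freeness
    gives [v = 0]. *)
Lemma gram_unitmx (R : realFieldType) (m n : nat) (A : 'M[R]_(m, n)) :
  row_free A -> A *m A^T \in unitmx.
Proof.
move=> freeA; rewrite -row_free_unit; apply: inj_row_free => v vAA0.
apply: (row_free_inj freeA); rewrite mul0mx; apply: gram_eq0.
by rewrite trmx_mul mulmxA -(mulmxA v) vAA0 mul0mx.
Qed.

Lemma orthogonal_projector_ker {R : realFieldType} {m n : nat}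
    (G : 'M[R]_(m, n)) :
  exists P : 'M[R]_n,
    [/\ P^T = P, P *m P = P, G *m P = 0, \tr P = n%:R - (\rank G)%:R &
        forall p (X : 'M[R]_(n, p)), G *m X = 0 -> P *m X = X].
Proof.
have [B [freeB /submxP[C defG] /submxP[D defB]]] :
    exists B : 'M_(\rank G, n), [/\ row_free B, (G <= B)%MS & (B <= G)%MS].
  by exists (row_base G); rewrite row_base_free !eq_row_base submx_refl.
have uBB : B *m B^T \in unitmx by apply: gram_unitmx.
(* [Q] is the orthogonal projector onto the row space of [G], written in the row basis [B]; its
   complement [1%:M - Q] projects onto the kernel. *)
set Q := B^T *m invmx (B *m B^T) *m B.
have BQ : B *m Q = B by rewrite /Q !mulmxA mulmxV // mul1mx.
have QT : Q^T = Q by rewrite /Q !trmx_mul trmxK trmx_inv trmx_mul trmxK mulmxA.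
have QQ : Q *m Q = Q by rewrite {1}/Q -mulmxA BQ.
have GQ : G *m Q = G by rewrite {1}defG -mulmxA BQ -defG.
have trQ : \tr Q = (\rank G)%:R.
  (* Cyclicity of the trace reduces [Q] to the identity of size [\rank G]. *)
  by rewrite /Q mxtrace_mulC mulmxA mulmxV // mxtrace1.
exists (1%:M - Q); split.
- by rewrite linearB /= trmx1 QT.
- by rewrite mulmxBl mul1mx mulmxBr mulmx1 QQ subrr subr0.
- by rewrite mulmxBr mulmx1 GQ subrr.
- by rewrite linearB /= mxtrace1 trQ.
move=> p X GX0; rewrite mulmxBl mul1mx.
have BX0 : B *m X = 0 by rewrite defB -mulmxA GX0 mulmx0.
by rewrite /Q -(mulmxA _ B) BX0 mulmx0 subr0.
Qed.

Lemma psdmx_diag_ge0 (R : realType) (n : nat) (A : 'M[R]_n) (i : 'I_n) :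
  psdmx A -> 0 <= A i i.
Proof.
move=> [_ /(_ (delta_mx i 0))].
by rewrite trmx_delta -rowE -colE !mxE.
Qed.

Lemma psdmx_congr {R : realType} {n p : nat} {A : 'M[R]_n} (B : 'M[R]_(n, p)) :
  psdmx A -> psdmx (B^T *m A *m B).
Proof.
move=> [/symmetricmxP symA psdA]; split.
  by apply/symmetricmxP; rewrite !trmx_mul trmxK symA mulmxA.
by move=> x; have := psdA (B *m x); rewrite trmx_mul !mulmxA.
Qed.

Lemma psdmx_tr_ge0 {R : realType} {n : nat} {A : 'M[R]_n} :
  psdmx A -> 0 <= \tr A.
Proof. by move=> psdA; apply: sumr_ge0 => i _; apply: psdmx_diag_ge0. Qed.

Lemma psdmxD (R : realType) (n : nat) (A B : 'M[R]_n) :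
  psdmx A -> psdmx B -> psdmx (A + B).
Proof.
move=> [/symmetricmxP symA psdA] [/symmetricmxP symB psdB]; split.
  by apply/symmetricmxP; rewrite linearD /= symA symB.
by move=> x; rewrite mulmxDr mulmxDl mxE addr_ge0.
Qed.

Lemma psdmxZ (R : realType) (n : nat) (c : R) (A : 'M[R]_n) :
  0 <= c -> psdmx A -> psdmx (c *: A).
Proof.
move=> c_ge0 [/symmetricmxP symA psdA]; split.
  by apply/symmetricmxP; rewrite linearZ /= symA.
by move=> x; rewrite -scalemxAr -scalemxAl mxE mulr_ge0.
Qed.

Lemma psdmx1 (R : realType) (n : nat) : psdmx (1%:M : 'M[R]_n).
Proof.
split; first by apply/symmetricmxP; rewrite trmx1.
by move=> x; rewrite mulmx1 -{2}(trmxK x) gram_diag_ge0.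
Qed.

Lemma projector_psdmx (R : realType) (n : nat) (P : 'M[R]_n) :
  P^T = P -> P *m P = P -> psdmx P.
Proof.
by move=> symP PP; have := psdmx_congr P (psdmx1 R n); rewrite symP mulmx1 PP.
Qed.

Lemma Phi_ker_rank {R : realType} {m n : nat} {r : R} {G : 'M[R]_(m, n)}
    {W : 'M[R]_n} :
  Phi n r W -> G *m W = 0 -> (\rank G)%:R <= r.
Proof.
move=> [/symmetricmxP symW _ W_le1 trW] GW0.
have [P [symP PP _ trP Pid]] := orthogonal_projector_ker G.
have PW : P *m W = W by apply: Pid.
have WP : W *m P = W by rewrite -{1}symW -symP -trmx_mul PW symW.
(* Compressing [1%:M - W] by [P] leaves [P - W], whose trace is [r - \rank G]. *)
have := psdmx_tr_ge0 (psdmx_congr P W_le1).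
rewrite symP mulmxBr mulmx1 PW mulmxBl PP WP linearB /= trP trW.
by rewrite subr_ge0 lerD2l lerN2.
Qed.

Lemma rank_Phi_ker {R : realType} {m n : nat} {r : R} {G : 'M[R]_(m, n)} :
  r <= n%:R -> (\rank G)%:R <= r -> exists2 W, Phi n r W & G *m W = 0.
Proof.
move=> le_rn le_Gr.
have [P [symP PP GP0 trP _]] := orthogonal_projector_ker G.
have psdP : psdmx P by apply: projector_psdmx.
have psd1P : psdmx (1%:M - P).
  apply: projector_psdmx; first by rewrite linearB /= trmx1 symP.
  by rewrite mulmxBl mul1mx mulmxBr mulmx1 PP subrr subr0.
(* If [\rank G = n] then [r = n], and the junk value [c = 0 / 0 = 0] is the
   right one. *)
set k : R := n%:R - (\rank G)%:R; set c := (n%:R - r) / k.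
have le_nr_k : n%:R - r <= k by rewrite lerD2l lerN2.
have nr_ge0 : 0 <= n%:R - r by rewrite subr_ge0.
have k_ge0 : 0 <= k by apply: le_trans le_nr_k.
have c_ge0 : 0 <= c by rewrite divr_ge0.
have ck : c * k = n%:R - r.
  have [k0|k_neq0] := eqVneq k 0; last by rewrite divfK.
  by rewrite k0 mulr0; apply/eqP; rewrite eq_le nr_ge0 -{1}k0 le_nr_k.
have c_le1 : c <= 1.
  have [k0|k_neq0] := eqVneq k 0; first by rewrite /c k0 invr0 mulr0 ler01.
  by rewrite ler_pdivrMr ?mul1r // lt_def k_neq0.
exists (c *: P); last by rewrite -scalemxAr GP0 scaler0.
split.
- by apply/symmetricmxP; rewrite linearZ /= symP.
- by rewrite /loewner_le subr0; apply: psdmxZ.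
(* Splitting along the two complementary projectors makes [c <= 1] suffice. *)
- have -> : loewner_le (c *: P) 1%:M = psdmx ((1%:M - P) + (1 - c) *: P).
    by rewrite /loewner_le scalerBl scale1r addrA subrK.
  by apply: psdmxD => //; apply: psdmxZ; rewrite // subr_ge0.
- by rewrite linearZ /= trP.
Qed.

(** The bounds on [r] cannot be dropped: members of [Phi n r] have nonnegative trace, so for
    [r > n%:R] this set is empty although the rank bound holds; likewise for [m]. *)
Theorem theorem1 (R : realType) (m n : nat) (r : R) (G : 'M[R]_(m, n))
    (hrm : r <= m%:R) (hrn : r <= n%:R) :
  [<-> (\rank G)%:R <= r;
       exists2 W_R : 'M[R]_n, Phi n r W_R & G *m W_R = 0;
       exists2 W_L : 'M[R]_m, Phi m r W_L & W_L *m G = 0].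
Proof.
tfae.
- exact: rank_Phi_ker.
- move=> [W PhiW GW0]; have := Phi_ker_rank PhiW GW0.
  (* The kernel construction is applied to [G^T], which has the same rank; since [V] is symmetric,
     transposing [G^T *m V = 0] gives [V *m G = 0]. *)
  rewrite -mxrank_tr => /(rank_Phi_ker hrm)[V PhiV GV0]; exists V => //.
  have [/symmetricmxP symV _ _ _] := PhiV.
  by apply: trmx_inj; rewrite trmx_mul symV GV0 trmx0.
- move=> [V PhiV VG0]; rewrite -mxrank_tr; apply: (Phi_ker_rank PhiV).
  have [/symmetricmxP symV _ _ _] := PhiV.
  by rewrite -symV -trmx_mul VG0 trmx0.
Qed.
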